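(* Let $\Sigma$ be an $X$-symmetric graph with valency $\mathrm v\ge2$, let $1\le\kappa\le\mathrm v-1$, and let $\Theta$ be a self-paired $X$-symmetric orbit on $DSt^\kappa(\Sigma)$. Let $\Gamma=\Pi(\Sigma,\Theta)$, $\mathcal S=St(\Theta)$ and $\mathcal B=\{\mathcal S_\tau:\tau\in V(\Sigma)\}$, where $\mathcal S_\tau$ is the set of stars in $\mathcal S$ centred at $\tau$. Then $(\Gamma,X,\mathcal B)\in\mathcal G$, $\Gamma_{\mathcal B}\cong\Sigma$, and for $B=\mathcal S_\tau\in\mathcal B$ the incidence structure $\mathcal D(B)$ is isomorphic to the dual $\mathbb D^*(\tau)$ of $\mathbb D(\tau)$.
   Context: Graphs are finite, simple, undirected; $\Sigma(\tau)$ is the neighbourhood. $\Sigma$ is $X$-symmetric if $X$ acts on $V(\Sigma)$ preserving adjacency and transitively on vertices and on arcs (ordered pairs of adjacent vertices). Stars: for $S\subseteq\Sigma(\tau)$ with $|S|=\kappa$, the $\kappa$-star is $\mathfrak s(\tau,S)=\{(\tau,\sigma):\sigma\in S\}$ (centred at $\tau$). A star $\mathfrak s(\tau,S)$ is symmetric if $X_\tau\cap X_S$ is transitive on $S$; a set of stars is $X$-symmetric if it is a single $X$-orbit containing a symmetric star. A $\kappa$-double star is a pair $(\mathfrak l,\mathfrak r)$ of $\kappa$-stars $\mathfrak l=\mathfrak s(\tau,L)$, $\mathfrak r=\mathfrak s(\sigma,R)$ with $\sigma\in L$, $\tau\in R$; $DSt^\kappa(\Sigma)$ is the set of them. For $\Theta\subseteq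 DSt^\kappa(\Sigma)$, $St(\Theta)=\{\mathfrak l,\mathfrak r:(\mathfrak l,\mathfrak r)\in\Theta\}$; an $X$-orbit $\Theta$ is $X$-symmetric if $St(\Theta)$ is $X$-symmetric, and self-paired if $(\mathfrak l,\mathfrak r)\in\Theta$ implies $(\mathfrak r,\mathfrak l)\in\Theta$. $\Pi(\Sigma,\Theta)$ is the graph with vertex set $St(\Theta)$, $\mathfrak l\sim\mathfrak r$ iff $(\mathfrak l,\mathfrak r)\in\Theta$. $\mathbb D(\tau)$ is the incidence structure with point set $\Sigma(\tau)$, block set $\mathcal S_\tau$, with $\sigma$ incident with $\mathfrak s(\tau,S)$ iff $\sigma\in S$; its dual interchanges points and blocks. For an $X$-symmetric graph $\Gamma$ and $X$-invariant partition $\mathcal B$: $\Gamma_{\mathcal B}$ is the quotient graph on $\mathcal B$ ($B\sim C$ iff some vertex of $B$ is adjacent to some vertex of $C$); $\Gamma(C)=\bigcup_{\mathfrak u\in C}\Gamma(\mathfrak u)$; $\Gamma_{\mathcal B}(\mathfrak v)=\{C\in\mathcal B:\mathfrak v\in\Gamma(C)\}$; $\mathcal D(B)$ has point set $B$, block set the neighbourhood $\Gamma_{\mathcal B}(B)$ of $B$ in $\Gamma_{\mathcal B}$, with $\mathfrak v$ incident with $C$ iff $C\in\Gamma_{\mathcal B}(\mathfrak v)$. $\Gamma$ is a multicover of $\Gamma_{\mathcal B}$ if $|\Gamma(C)\cap B|=|B|$ for adjacent $B,C$. $\mathcal G$ is the set of triples $(\Gamma,X,\mathcal B)$ with $\Gamma$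 finite $X$-symmetric, $\mathcal B$ an $X$-invariant partition with $1<|B|<|V(\Gamma)|$, $val(\Gamma_{\mathcal B})\ge2$, and $\Gamma$ not a multicover of $\Gamma_{\mathcal B}$. *)

(* Defs.v *)
From mathcomp Require Import all_boot all_fingroup.
Set Implicit Arguments.
Unset Strict Implicit.
Unset Printing Implicit Defensive.

(* Group actions.  The acting group X is an arbitrary, possibly infinite,
   [groupType], and acts on the right: [to a x] is a^x.  An action on a set
   A : {set T} is a function on the ambient type T whose values outside A are
   irrelevant. *)

Definition acts_on (X : groupType) (T : finType) (to : T -> X -> T)
    (A : {set T}) : Prop :=
  [/\ forall a x, a \in A -> to a x \in A,
      forall a, a \in A -> to a 1%g = a
    & forall a x y, a \in A -> to a (x * y)%g = to (to a x) y].

(* H : X -> Prop stands for a subgroup of X; "H is transitive on A" also means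
   that A is an H-orbit. *)
Definition is_orbit (X : groupType) (T : finType) (to : T -> X -> T)
    (H : X -> Prop) (A : {set T}) : Prop :=
  exists2 a, a \in A & forall b, b \in A <-> exists2 x, H x & b = to a x.

Definition whole (X : groupType) : X -> Prop := fun _ => True.

Definition stabilizes (X : groupType) (T : Type) (to : T -> X -> T) (a : T) :
    X -> Prop :=
  fun x => to a x = a.

Definition act_pair (X : groupType) (T : finType) (to : T -> X -> T)
    (p : T * T) (x : X) : T * T :=
  (to p.1 x, to p.2 x).

Definition act_set (X : groupType) (T : finType) (to : T -> X -> T)
    (A : {set T}) (x : X) : {set T} :=
  [set to a x | a in A].

Record graph (T : finType) := Graph { vset : {set T}; adj : rel T }.

Definition simple_graph (T : finType) (G : graph T) : Prop :=
  [/\ forall u v, adj G u v -> (u \in vset G) && (v \in vset G),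
      symmetric (adj G)
    & irreflexive (adj G)].

Definition nbh (T : finType) (G : graph T) (u : T) : {set T} :=
  [set v | adj G u v].

Definition arcs (T : finType) (G : graph T) : {set T * T} :=
  [set p | adj G p.1 p.2].

Definition has_valency (T : finType) (G : graph T) (n : nat) : Prop :=
  forall u, u \in vset G -> #|nbh G u| = n.

Definition symmetric_graph (X : groupType) (T : finType) (to : T -> X -> T)
    (G : graph T) : Prop :=
  [/\ simple_graph G,
      acts_on to (vset G),
      forall u v x, u \in vset G -> v \in vset G ->
        adj G (to u x) (to v x) = adj G u v,
      is_orbit to (@whole X) (vset G)
    & is_orbit (act_pair to) (@whole X) (arcs G)].

Definition graph_iso (T1 T2 : finType) (G1 : graph T1) (G2 : graph T2) : Prop :=
  exists f : T1 -> T2,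
    [/\ {in vset G1 &, injective f},
        f @: vset G1 = vset G2
      & {in vset G1 &, forall u v, adj G2 (f u) (f v) = adj G1 u v}].

Record incidence (P Q : finType) :=
  Incidence { points : {set P}; blocks : {set Q}; inc : P -> Q -> bool }.

Definition dual (P Q : finType) (D : incidence P Q) : incidence Q P :=
  Incidence (blocks D) (points D) (fun b p => inc D p b).

Definition incidence_iso (P1 Q1 P2 Q2 : finType)
    (D1 : incidence P1 Q1) (D2 : incidence P2 Q2) : Prop :=
  exists (f : P1 -> P2) (g : Q1 -> Q2),
    [/\ {in points D1 &, injective f} /\ f @: points D1 = points D2,
        {in blocks D1 &, injective g} /\ g @: blocks D1 = blocks D2
      & forall p b, p \in points D1 -> b \in blocks D1 ->
          inc D2 (f p) (g b) = inc D1 p b].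

Definition quotient_graph (T : finType) (G : graph T) (BB : {set {set T}}) :
    graph {set T} :=
  Graph BB (fun B C => [&& B \in BB, C \in BB &
    [exists u in B, exists v in C, adj G u v]]).

Definition nbh_set (T : finType) (G : graph T) (C : {set T}) : {set T} :=
  \bigcup_(u in C) nbh G u.

Definition block_nbh (T : finType) (G : graph T) (BB : {set {set T}}) (v : T) :
    {set {set T}} :=
  [set C in BB | v \in nbh_set G C].

Definition block_design (T : finType) (G : graph T) (BB : {set {set T}})
    (B : {set T}) : incidence T {set T} :=
  Incidence B (nbh (quotient_graph G BB) B) (fun v C => C \in block_nbh G BB v).

Definition multicover (T : finType) (G : graph T) (BB : {set {set T}}) : Prop :=
  forall B C, adj (quotient_graph G BB) B C -> #|nbh_set G C :&: B| = #|B|.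

Definition invariant_partition (X : groupType) (T : finType)
    (to : T -> X -> T) (G : graph T) (BB : {set {set T}}) : Prop :=
  partition BB (vset G) /\ forall B x, B \in BB -> act_set to B x \in BB.

Definition in_calG (X : groupType) (T : finType) (to : T -> X -> T)
    (G : graph T) (BB : {set {set T}}) : Prop :=
  [/\ symmetric_graph to G,
      invariant_partition to G BB,
      forall B, B \in BB -> 1 < #|B| < #|vset G|,
      exists2 n, 2 <= n & has_valency (quotient_graph G BB) n
    & ~ multicover G BB].

Definition star (T : finType) (tau : T) (S : {set T}) : {set T * T} :=
  [set (tau, sigma) | sigma in S].

Definition act_star (X : groupType) (T : finType) (to : T -> X -> T) :
    {set T * T} -> X -> {set T * T} :=
  act_set (act_pair to).

Definition act_dstar (X : groupType) (T : finType) (to : T -> X -> T) :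
    {set T * T} * {set T * T} -> X -> {set T * T} * {set T * T} :=
  act_pair (act_star to).

Definition symmetric_star (X : groupType) (T : finType) (to : T -> X -> T)
    (G : graph T) (s : {set T * T}) : Prop :=
  exists (tau : T) (S : {set T}),
    [/\ S \subset nbh G tau, s = star tau S
      & is_orbit to
          (fun x => stabilizes to tau x /\ stabilizes (act_set to) S x) S].

Definition symmetric_star_set (X : groupType) (T : finType) (to : T -> X -> T)
    (G : graph T) (SS : {set {set T * T}}) : Prop :=
  is_orbit (act_star to) (@whole X) SS /\
  exists2 s, s \in SS & symmetric_star to G s.

Definition DSt (T : finType) (G : graph T) (k : nat) :
    {set {set T * T} * {set T * T}} :=
  [set d | [exists tau : T, exists sigma : T,
            exists L : {set T}, exists R : {set T},
    [&& L \subset nbh G tau, #|L| == k, R \subset nbh G sigma, #|R| == k,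
        sigma \in L, tau \in R & d == (star tau L, star sigma R)]]].

Definition St (T : finType) (Th : {set {set T * T} * {set T * T}}) :
    {set {set T * T}} :=
  [set d.1 | d in Th] :|: [set d.2 | d in Th].

Definition symmetric_dstar_orbit (X : groupType) (T : finType)
    (to : T -> X -> T) (G : graph T) (k : nat)
    (Th : {set {set T * T} * {set T * T}}) : Prop :=
  [/\ Th \subset DSt G k,
      is_orbit (act_dstar to) (@whole X) Th
    & symmetric_star_set to G (St Th)].

Definition self_paired (T : finType) (Th : {set {set T * T} * {set T * T}}) :
    Prop :=
  forall l r, (l, r) \in Th -> (r, l) \in Th.

Definition Pi_graph (T : finType) (Th : {set {set T * T} * {set T * T}}) :
    graph {set T * T} :=
  Graph (St Th) (fun l r => (l, r) \in Th).

Definition stars_at (T : finType) (G : graph T) (SS : {set {set T * T}})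
    (tau : T) : {set {set T * T}} :=
  [set s in SS | [exists S : {set T}, (S \subset nbh G tau) && (s == star tau S)]].

(* For s = star tau S, sigma \in S iff (tau, sigma) \in s. *)
Definition star_design (T : finType) (G : graph T) (SS : {set {set T * T}})
    (tau : T) : incidence T {set T * T} :=
  Incidence (nbh G tau) (stars_at G SS tau) (fun sigma s => (tau, sigma) \in s).

(* Main.v *)
From mathcomp Require Import all_boot all_fingroup.
Require Import Defs.

Set Implicit Arguments.
Unset Strict Implicit.
Unset Printing Implicit Defensive.

(** Arc-transitivity puts every arc of Sigma in some star of St(Theta).  The
   symmetric star makes this sharper: transporting a neighbour of that star
   along its stabilizer shows that for every star l and every arc (tau, sigma)
   of l there is a star r containing (sigma, tau) with l ~ r.  Conversely
   l ~ r forces such a pair of opposite arcs.  Hence the star l at tau has a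
   neighbour at sigma iff sigma is a leaf of l, which gives both isomorphisms;
   and since a star misses some neighbour of its centre (k < v), no block is
   a singleton and Gamma is not a multicover. *)

(** * Actions on pairs and subsets, and transitivity within orbits *)

Section Actions.

Variables (X : groupType) (T : finType).
Implicit Types (to : T -> X -> T) (A B : {set T}).

Lemma acts_on_pair to A :
  acts_on to A -> acts_on (act_pair to) (setX A A).
Proof.
case=> cl a1 aM; split.
- by move=> [a b] x; rewrite !inE /= => /andP[aA bA]; rewrite !cl.
- by move=> [a b]; rewrite !inE /= => /andP[aA bA]; rewrite /act_pair /= !a1.
- move=> [a b] x y; rewrite !inE /= => /andP[aA bA].
  by rewrite /act_pair /= !aM.
Qed.

Lemma acts_on_powerset to A :
  acts_on to A -> acts_on (act_set to) (powerset A).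
Proof.
case=> cl a1 aM; split.
- move=> B x; rewrite !inE => /subsetP sBA.
  by apply/subsetP=> _ /imsetP[b /sBA bA ->]; apply: cl.
- move=> B; rewrite inE => /subsetP sBA; rewrite -[RHS]imset_id.
  by apply: eq_in_imset => b /sBA /a1.
- move=> B x y; rewrite inE => /subsetP sBA.
  rewrite /act_set -imset_comp; apply: eq_in_imset => b /sBA bA.
  exact: aM.
Qed.

Lemma acts_onK to A a x :
  acts_on to A -> a \in A -> to (to a x) x^-1%g = a.
Proof. by case=> cl a1 aM aA; rewrite -aM // mulgV a1. Qed.

Lemma acts_onKV to A a x :
  acts_on to A -> a \in A -> to (to a x^-1%g) x = a.
Proof. by case=> cl a1 aM aA; rewrite -aM // mulVg a1. Qed.

Lemma stabilizes_div to A a x y : acts_on to A -> a \in A ->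
  stabilizes to a x -> stabilizes to a y -> stabilizes to a (x^-1 * y)%g.
Proof.
move=> hA aA ax ay; have ax' : to a x^-1%g = a.
  by rewrite -{1}ax (acts_onK _ hA).
by case: hA => _ _ aM; rewrite /stabilizes aM // ax'.
Qed.

(** If [b] and [c] are the images of the base point under [x] and [y], then [x^-1 * y] takes [b] to
    [c]. Only [A] carries the action: [B] may be an orbit of a subgroup that [X] does not preserve,
    such as the leaf set of a star. *)
Lemma orbit_trans to (H : X -> Prop) A B b c :
    (forall x y, H x -> H y -> H (x^-1 * y)%g) ->
    acts_on to A -> B \subset A -> is_orbit to H B -> b \in B -> c \in B ->
  exists2 x, H x & c = to b x.
Proof.
move=> Hdiv hA /subsetP sBA [a aB orb] /orb[x Hx ->] /orb[y Hy ->].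
exists (x^-1 * y)%g; first exact: Hdiv.
have aA := sBA _ aB; case: (hA) => cl _ aM.
by rewrite aM ?cl // (acts_onK _ hA).
Qed.

Lemma orbit_stable to A B b x :
    acts_on to A -> B \subset A -> is_orbit to (@whole X) B -> b \in B ->
  to b x \in B.
Proof.
case=> cl a1 aM /subsetP sBA [a aB orb] /orb[y _ ->]; apply/orb.
by exists (y * x)%g; rewrite // aM // sBA.
Qed.

End Actions.

(** * Stars and double stars as sets of arcs *)

Lemma mem_star (V : finType) (tau : V) S a b :
  ((a, b) \in star tau S) = (a == tau) && (b \in S).
Proof.
apply/imsetP/andP => [[s sS [-> ->]] | [/eqP -> bS]]; last by exists b.
by rewrite eqxx.
Qed.

Lemma act_star_star (X : groupType) (V : finType) (to : V -> X -> V) tau S x :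
  act_star to (star tau S) x = star (to tau x) (act_set to S x).
Proof. by rewrite /act_star /act_set /star -!imset_comp. Qed.

Lemma mem_act_star (X : groupType) (V : finType) (to : V -> X -> V)
    (s : {set V * V}) a b x :
  (a, b) \in s -> (to a x, to b x) \in act_star to s x.
Proof. exact: (imset_f (act_pair to ^~ x)). Qed.

Section DoubleStarGraph.

Variables (X : groupType) (V : finType) (to : V -> X -> V).
Variables (Sigma : graph V) (v k : nat).
Variable Theta : {set {set V * V} * {set V * V}}.
Hypothesis hSigma : symmetric_graph to Sigma.
Hypothesis hval : has_valency Sigma v.
Hypothesis hv : 2 <= v.
Hypothesis hk : 1 <= k <= v - 1.
Hypothesis hTheta : symmetric_dstar_orbit to Sigma k Theta.
Hypothesis hpaired : self_paired Theta.

Let A := vset Sigma.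
Let SS := St Theta.
Let S_ := stars_at Sigma SS.
Let BB := [set S_ tau | tau in A].
Let Gamma := Pi_graph Theta.

Implicit Types (s l r : {set V * V}) (tau sigma : V) (x : X).

Lemma adj_vset a b : adj Sigma a b -> (a \in A) /\ (b \in A).
Proof. by case: hSigma => [[h _ _] _ _ _ _] /h /andP. Qed.

Lemma dstarP l r : (l, r) \in Theta ->
  exists tau sigma, [/\ adj Sigma tau sigma, (tau, sigma) \in l
    & (sigma, tau) \in r].
Proof.
case: hTheta => /subsetP sub _ _ /sub.
rewrite inE => /existsP[tau /existsP[sigma /existsP[L /existsP[R]]]].
case/and5P=> /subsetP Ln _ _ _ /and3P[sL tR /eqP[-> ->]].
exists tau, sigma; rewrite !mem_star !eqxx sL tR; split => //.
by have := Ln _ sL; rewrite inE.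
Qed.

Lemma mem_St_l l r : (l, r) \in Theta -> l \in SS.
Proof. by move=> h; rewrite inE; apply/orP; left; apply/imsetP; exists (l, r). Qed.

Lemma mem_St_r l r : (l, r) \in Theta -> r \in SS.
Proof. by move/hpaired; apply: mem_St_l. Qed.

(** Self-pairing turns a right component into a left one, so every star may be taken as the left
    star of some double star. *)
Lemma St_nbr s : s \in SS -> exists r, (s, r) \in Theta.
Proof.
rewrite inE => /orP[] /imsetP[[l r] h /= ->]; first by exists r.
by exists l; apply: hpaired.
Qed.

Lemma StP s : s \in SS ->
  exists tau (S : {set V}), [/\ S \subset nbh Sigma tau, #|S| = k & s = star tau S].
Proof.
case/St_nbr=> r; case: hTheta => /subsetP sub _ _ /sub.
rewrite inE => /existsP[tau /existsP[sigma /existsP[L /existsP[R]]]].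
case/and5P=> Ln /eqP Lk _ _ /and3P[sL tR /eqP[-> _]].
by exists tau, L.
Qed.

Lemma St_adj s a b : s \in SS -> (a, b) \in s -> adj Sigma a b.
Proof.
case/StP=> tau [S [/subsetP Sn _ ->]]; rewrite mem_star => /andP[/eqP -> /Sn].
by rewrite inE.
Qed.

Lemma St_center s a b c d : s \in SS -> (a, b) \in s -> (c, d) \in s -> a = c.
Proof.
case/StP=> tau [S [_ _ ->]]; rewrite !mem_star.
by move=> /andP[/eqP -> _] /andP[/eqP -> _].
Qed.

Lemma St_arc s : s \in SS -> exists tau sigma, (tau, sigma) \in s.
Proof. by case/St_nbr=> r /dstarP[a [b [_ h _]]]; exists a, b. Qed.

(** Stars of [SS] are nonempty and all their arcs share one origin, so a single arc starting at
    [tau] identifies the centre and the leaf set can be forgotten. *)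
Lemma stars_atP s tau :
  reflect (s \in SS /\ exists sigma, (tau, sigma) \in s) (s \in S_ tau).
Proof.
rewrite [s \in S_ tau]in_set; apply: (iffP andP) => -[sS].
  case/existsP=> S /andP[_ /eqP es]; split=> //.
  have [a [b h]] := St_arc sS; exists b; move: h.
  by rewrite es !mem_star eqxx => /andP[].
case=> sigma h; split => //; apply/existsP.
have [t [S [Sn _ es]]] := StP sS; exists S.
by move: h; rewrite es mem_star => /andP[/eqP -> _]; rewrite Sn eqxx.
Qed.

(** The action laws of [to] hold only on [A]; this inclusion makes the induced action laws available
    for stars. *)
Lemma St_arcs : SS \subset powerset (setX A A).
Proof.
apply/subsetP=> s sS; rewrite inE; apply/subsetP=> -[a b] /(St_adj sS).
by case/adj_vset=> aA bA; rewrite inE /= aA bA.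
Qed.

Lemma Theta_arcs :
  Theta \subset setX (powerset (setX A A)) (powerset (setX A A)).
Proof.
apply/subsetP=> -[l r] h; rewrite in_setX.
by rewrite !(subsetP St_arcs) ?(mem_St_l h) ?(mem_St_r h).
Qed.

Lemma acts_on_vset : acts_on to A.
Proof. by case: hSigma. Qed.

Lemma acts_on_stars : acts_on (act_star to) (powerset (setX A A)).
Proof. exact/acts_on_powerset/acts_on_pair/acts_on_vset. Qed.

Lemma act_Theta l r x :
  (l, r) \in Theta -> (act_star to l x, act_star to r x) \in Theta.
Proof.
case: hTheta => _ orb _ h.
exact: (orbit_stable x (acts_on_pair acts_on_stars) Theta_arcs orb h).
Qed.

Lemma act_St s x : s \in SS -> act_star to s x \in SS.
Proof. by case/St_nbr=> r /(act_Theta x); apply: mem_St_l. Qed.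

Lemma act_starK s x : s \in SS -> act_star to (act_star to s x) x^-1%g = s.
Proof. by move/(subsetP St_arcs)/(acts_onK x acts_on_stars). Qed.

Lemma act_starKV s x : s \in SS -> act_star to (act_star to s x^-1%g) x = s.
Proof. by move/(subsetP St_arcs)/(acts_onKV x acts_on_stars). Qed.

(** [St_nbr] gives a neighbour of [l] at an uncontrolled leaf; leaf-transitivity of the symmetric
    star moves it to the prescribed leaf [sigma]. *)
Lemma St_arc_nbr l tau sigma : l \in SS -> (tau, sigma) \in l ->
  exists2 r, (l, r) \in Theta & (sigma, tau) \in r.
Proof.
move=> lS h; case: hTheta => _ _ [orbS [s0 s0S [t0 [S0 [S0n es0 orb0]]]]].
have [tA sA] := adj_vset (St_adj lS h).
have [r0 h0] := St_nbr s0S.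
have [t [u [tu]]] := dstarP h0; rewrite {1}es0 mem_star => /andP[/eqP -> uS] ut.
(* [x] takes [l] to the symmetric star [s0], hence [tau] to [t0] and [sigma] to a leaf of [s0]. *)
have [x _ ex] := orbit_trans (fun _ _ _ _ => I) acts_on_stars St_arcs orbS lS s0S.
have := mem_act_star to x h; rewrite -ex es0 mem_star => /andP[/eqP etx sxS].
have sS0A : S0 \subset A.
  apply/subsetP=> b /(subsetP S0n); rewrite inE.
  by case/adj_vset.
have t0A : t0 \in A by rewrite -etx; case: acts_on_vset => cl _ _; apply: cl.
(* [y] fixes [s0] and takes the leaf [u], the centre of [r0], to the image of [sigma] under [x]. *)
have [|y [ty Sy] eu] := orbit_trans _ acts_on_vset sS0A orb0 uS sxS.
  move=> y z [y1 y2] [z1 z2]; split.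
    exact: stabilizes_div acts_on_vset t0A y1 z1.
  by apply: stabilizes_div (acts_on_powerset acts_on_vset) _ y2 z2; rewrite inE.
(* Moving [(s0, r0)] by [y] and then by [x^-1] yields left star [l], and the arc [(u, t0)] of [r0]
   becomes [(sigma, tau)]. *)
have := act_Theta x^-1%g (act_Theta y h0).
rewrite {1}es0 act_star_star ty Sy -es0 ex act_starK // => hr.
exists (act_star to (act_star to r0 y) x^-1%g) => //.
have := mem_act_star to x^-1%g (mem_act_star to y ut).
by rewrite -eu ty -etx !(acts_onK _ acts_on_vset).
Qed.

Lemma arc_in_St tau sigma :
  adj Sigma tau sigma -> exists2 l, l \in SS & (tau, sigma) \in l.
Proof.
move=> ts; case: hSigma hTheta => _ _ _ _ orbA [_ _ [_ [s0 s0S _]]].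
have [a [b ab]] := St_arc s0S.
have sub : arcs Sigma \subset setX A A.
  by apply/subsetP=> -[c d]; rewrite !inE /= => /adj_vset[-> ->].
have [||x _ [-> ->]] := orbit_trans (b := (a, b)) (c := (tau, sigma))
  (fun _ _ _ _ => I) (acts_on_pair acts_on_vset) sub orbA.
- by rewrite inE; apply: St_adj ab.
- by rewrite inE.
by exists (act_star to s0 x); [apply: act_St | apply: mem_act_star].
Qed.

(** * Blocks of stars and the quotient graph *)

Lemma nbh_exists tau : tau \in A -> exists sigma, adj Sigma tau sigma.
Proof.
move=> tA; have : 0 < #|nbh Sigma tau| by rewrite hval // ltnW.
by case/card_gt0P=> s; rewrite inE; exists s.
Qed.

(** The bound [k <= v - 1] enters here: the [k] leaves cannot exhaust the [v] neighbours of the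
    centre. *)
Lemma star_misses_nbr tau l : l \in S_ tau ->
  exists2 sigma, adj Sigma tau sigma & (tau, sigma) \notin l.
Proof.
case/stars_atP=> lS [b h]; have [t [S [Sn Sk es]]] := StP lS.
have et : tau = t by move: h; rewrite es mem_star => /andP[/eqP].
have tA : t \in A by case: (adj_vset (St_adj lS h)); rewrite et.
have : ~~ (nbh Sigma t \subset S).
  apply/negP=> /subset_leq_card; rewrite hval // Sk.
  case/andP: hk => _ kv /leq_trans /(_ kv).
  by rewrite leqNgt ltn_subrL (ltnW hv).
case/subsetPn=> s; rewrite inE => ts sS; exists s; rewrite et //.
by rewrite es mem_star negb_and sS orbT.
Qed.

Lemma stars_at_neq0 tau : tau \in A -> exists l, l \in S_ tau.
Proof.
case/nbh_exists=> s /arc_in_St[l lS h]; exists l; apply/stars_atP.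
by split=> //; exists s.
Qed.

Lemma stars_at_center l a b : l \in S_ a -> l \in S_ b -> a = b.
Proof. by case/stars_atP=> lS [c h] /stars_atP[_ [d]]; apply: St_center h. Qed.

Lemma stars_at_inj : {in A &, injective S_}.
Proof.
move=> a b /stars_at_neq0[l la] _ eab; apply: (stars_at_center la).
by rewrite -eab.
Qed.

(** From left to right, adjacent stars contain opposite arcs, whose ends must be the two centres;
    the converse is [St_arc_nbr]. Quotient adjacency, the failure of the multicover property and the
    incidence in the block design are all read off from this equivalence. *)
Lemma mem_nbh_stars_at l tau sigma : l \in S_ tau ->
  (l \in nbh_set Gamma (S_ sigma)) = ((tau, sigma) \in l).
Proof.
move=> /stars_atP[lS [c lc]]; apply/bigcupP/idP => [[r] | h].
  case/stars_atP=> rS [d rd]; rewrite inE /= => /hpaired/dstarP.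
  by case=> a [b [_ lab /(St_center rS rd) ->]]; rewrite (St_center lS lc lab).
have [r hr rst] := St_arc_nbr lS h; exists r; last by rewrite inE; apply: hpaired.
by apply/stars_atP; split; [apply: mem_St_r hr | exists tau].
Qed.

Lemma quotient_adj : {in A &, forall a b,
  adj (quotient_graph Gamma BB) (S_ a) (S_ b) = adj Sigma a b}.
Proof.
move=> a b aA bA; rewrite /= !imset_f //=; apply/exists_inP/idP.
  move=> [l la /exists_inP[r rb]] /= lr.
  have : l \in nbh_set Gamma (S_ b).
    by apply/bigcupP; exists r => //; rewrite inE; apply: hpaired.
  by rewrite (mem_nbh_stars_at _ la); apply: St_adj; apply: mem_St_l lr.
case/arc_in_St=> l lS h; have la : l \in S_ a by apply/stars_atP; split; last exists b.
exists l => //; apply/exists_inP; move: (h).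
rewrite -(mem_nbh_stars_at _ la) => /bigcupP[r rb]; rewrite inE => /hpaired rl.
by exists r.
Qed.

Lemma quotient_nbh tau : tau \in A ->
  nbh (quotient_graph Gamma BB) (S_ tau) = S_ @: nbh Sigma tau.
Proof.
move=> tA; apply/setP=> C; rewrite inE; apply/idP/imsetP.
  move=> h; have /imsetP[s sA eC] : C \in BB by case/and3P: h.
  by exists s => //; move: h; rewrite eC quotient_adj // inE.
case=> s; rewrite inE => ts ->; rewrite quotient_adj //.
by case/adj_vset: ts.
Qed.

Lemma partition_stars_at : partition BB SS.
Proof.
apply/and3P; split.
- apply/eqP/setP=> s; apply/bigcupP/idP => [[_ /imsetP[t _ ->]] | sS].
    by case/stars_atP.
  have [a [b ab]] := St_arc sS; exists (S_ a); last by apply/stars_atP; split; last exists b.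
  by apply: imset_f; case: (adj_vset (St_adj sS ab)).
- apply/trivIsetP=> _ _ /imsetP[a aA ->] /imsetP[b bA ->] nab.
  apply/pred0P=> s /=; apply/negP=> /andP[sa sb].
  by rewrite (stars_at_center sa sb) eqxx in nab.
- apply/imsetP=> -[a /stars_at_neq0[l la] e].
  by rewrite -e inE in la.
Qed.

Lemma act_stars_at tau x : tau \in A ->
  act_set (act_star to) (S_ tau) x = S_ (to tau x).
Proof.
move=> tA.
apply/setP=> s; apply/imsetP/stars_atP => [[l /stars_atP[lS [c lc]] ->] | [sS [c sc]]].
  by split; [apply: act_St | exists (to c x); apply: mem_act_star].
exists (act_star to s x^-1%g); last by rewrite act_starKV.
apply/stars_atP; split; first exact: act_St.
exists (to c x^-1%g); have := mem_act_star to x^-1%g sc.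
by rewrite (acts_onK _ acts_on_vset).
Qed.

Lemma card_stars_at tau : tau \in A -> 1 < #|S_ tau| < #|SS|.
Proof.
move=> tA; apply/andP; split.
  (* A second star at [tau] is one through a neighbour that [l] misses. *)
  have [l lt] := stars_at_neq0 tA; have [s ts ls] := star_misses_nbr lt.
  have [m mS ms] := arc_in_St ts; apply/card_gt1P; exists l, m; split=> //.
    by apply/stars_atP; split; last exists s.
  by apply: contraNneq ls => ->.
(* A star centred at a neighbour of [tau] lies outside the block. *)
apply: proper_card; apply/properP; split.
  by apply/subsetP=> l /stars_atP[].
have [s ts] := nbh_exists tA; have [_ sA] := adj_vset ts.
have [l ls] := stars_at_neq0 sA; exists l; first by case/stars_atP: ls.
apply/negP=> lt; move: ts; rewrite (stars_at_center lt ls).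
by case: hSigma => [[_ _ ->]].
Qed.

(** If [l] at [tau] misses the neighbour [s], then [l] has no neighbour in the block of [s],
    although the blocks of [tau] and [s] are adjacent. *)
Lemma not_multicover : ~ multicover Gamma BB.
Proof.
move=> mc; have [tau tA] : exists tau, tau \in A.
  by case: hSigma => _ _ _ [a aA _] _; exists a.
have [l lt] := stars_at_neq0 tA; have [s ts] := star_misses_nbr lt.
have [_ sA] := adj_vset ts.
rewrite -(mem_nbh_stars_at _ lt) => /negP[].
have := mc (S_ tau) (S_ s); rewrite quotient_adj // => /(_ ts) ec.
have /eqP e : nbh_set Gamma (S_ s) :&: S_ tau == S_ tau.
  by rewrite eqEcard subsetIr ec leqnn.
by move: lt; rewrite -{1}e inE => /andP[].
Qed.

(** * Symmetry of the star graph and membership in the class *)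

Lemma symmetric_Pi_graph : symmetric_graph (act_star to) Gamma.
Proof.
case: (hTheta) => _ orbT [orbS _]; split=> //.
- split=> [l r /= h | l r /= | l /=].
  + by rewrite (mem_St_l h) (mem_St_r h).
  + by apply/idP/idP; apply: hpaired.
  (* A star adjacent to itself would contain two opposite arcs with the same origin, giving a loop
     in [Sigma]. *)
  + apply/negP=> h; have [a [b [ab lab lba]]] := dstarP h.
    move: ab; rewrite (St_center (mem_St_l h) lab lba).
    by case: hSigma => [[_ _ ->]].
- case: acts_on_stars => cl a1 aM; split.
  + by move=> s x; apply: act_St.
  + by move=> s /(subsetP St_arcs); apply: a1.
  + by move=> s x y /(subsetP St_arcs); apply: aM.
- move=> l r x lS rS /=; apply/idP/idP; last exact: act_Theta.
  by move/(act_Theta x^-1%g); rewrite !act_starK.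
(* The arc set is literally [Theta], so arc-transitivity is the orbit hypothesis. *)
- suff -> : arcs Gamma = Theta by [].
  by apply/setP=> -[l r]; rewrite inE.
Qed.

Lemma in_calG_Pi_graph : in_calG (act_star to) Gamma BB.
Proof.
split.
- exact: symmetric_Pi_graph.
- split; first exact: partition_stars_at.
  move=> _ x /imsetP[t tA ->]; rewrite act_stars_at //; apply: imset_f.
  by case: acts_on_vset => cl _ _; apply: cl.
- by move=> _ /imsetP[t tA ->]; apply: card_stars_at.
- exists v => // _ /imsetP[t tA ->].
  rewrite quotient_nbh // card_in_imset ?hval // => a b.
  rewrite !inE => /adj_vset[_ aA] /adj_vset[_ bA]; exact: stars_at_inj.
- exact: not_multicover.
Qed.

(** * The two isomorphisms, through the centre of a block *)

(* [d] is a junk value, returned when [B] is not a block. *)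
Definition block_center (B : {set {set V * V}}) (d : V) : V :=
  odflt d [pick t in A | S_ t == B].

Lemma stars_atK d tau : tau \in A -> block_center (S_ tau) d = tau.
Proof.
move=> tA; rewrite /block_center; case: pickP => [t /andP[tA' /eqP e] | /(_ tau)].
  exact: stars_at_inj.
by rewrite tA eqxx.
Qed.

Lemma quotient_iso : graph_iso (quotient_graph Gamma BB) Sigma.
Proof.
have [d dA] : exists d, d \in A by case: hSigma => _ _ _ [a aA _] _; exists a.
exists (block_center ^~ d); split.
- move=> _ _ /imsetP[a aA ->] /imsetP[b bA ->].
  by rewrite !stars_atK // => ->.
- rewrite /= -imset_comp -[RHS]imset_id; apply: eq_in_imset => a aA /=.
  exact: stars_atK.
- move=> _ _ /imsetP[a aA ->] /imsetP[b bA ->].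
  by rewrite !stars_atK // quotient_adj.
Qed.

(** The points of the block design are already the blocks of the star design, so the point map is
    the identity; each adjacent block goes to its centre, and incidence is preserved by
    [mem_nbh_stars_at]. *)
Lemma block_design_iso tau : tau \in A ->
  incidence_iso (block_design Gamma BB (S_ tau))
                (dual (star_design Sigma SS tau)).
Proof.
move=> tA; have nA a : a \in nbh Sigma tau -> a \in A.
  by rewrite inE => /adj_vset[].
exists id, (block_center ^~ tau); split=> /=.
- by split; [move=> ? | rewrite imset_id].
- rewrite quotient_nbh //; split.
    move=> _ _ /imsetP[a /nA aA ->] /imsetP[b /nA bA ->].
    by rewrite !stars_atK // => ->.
  rewrite -imset_comp -[RHS]imset_id; apply: eq_in_imset => a /nA aA /=.
  exact: stars_atK.
- move=> l C lt; rewrite quotient_nbh // => /imsetP[a /nA aA ->].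
  by rewrite stars_atK // inE imset_f //= (mem_nbh_stars_at _ lt).
Qed.

End DoubleStarGraph.

Theorem theorem3p5 (X : groupType) (V : finType) (to : V -> X -> V)
  (Sigma : graph V) (v k : nat) (Theta : {set {set V * V} * {set V * V}})
  (hSigma : symmetric_graph to Sigma)
  (hval : has_valency Sigma v) (hv : 2 <= v) (hk : 1 <= k <= v - 1)
  (hTheta : symmetric_dstar_orbit to Sigma k Theta)
  (hpaired : self_paired Theta) :
  let Gamma := Pi_graph Theta in
  let SS := St Theta in
  let BB := [set stars_at Sigma SS tau | tau in vset Sigma] in
  [/\ in_calG (act_star to) Gamma BB,
      graph_iso (quotient_graph Gamma BB) Sigma
    & forall tau, tau \in vset Sigma ->
        incidence_iso (block_design Gamma BB (stars_at Sigma SS tau))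
                      (dual (star_design Sigma SS tau))].
Proof.
move=> Gamma SS BB; split.
- exact: in_calG_Pi_graph hSigma hval hv hk hTheta hpaired.
- exact: quotient_iso hSigma hval hv hTheta hpaired.
- move=> tau; exact: block_design_iso hSigma hval hv hTheta hpaired tau.
Qed.
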